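(* Let $\alpha>-1$, $\beta>0$ and, for $n\ge1$, put $$\chi_n=\frac{2(\beta+n-1)(n+\alpha+\beta-1)}{(2n+\alpha+\beta-1)(2n+\alpha+\beta-2)} .$$ Then: (i) $(\chi_n)$ satisfies, for all $n\ge2$, the nonlinear difference equation $$c^g_{n+1}-c^g_n+\chi_n-\chi_{n+1}-\frac{\lambda^g_{n+1}}{\chi_n}+\frac{\lambda^g_n}{\chi_{n-1}}=0 .$$ (ii) For all $n\ge1$, the quasi-Geronimus Jacobi polynomial $P^{QG}_n(x;-1)=\mathcal P^{(\alpha,\beta-1)}_n(x)+\chi_n\mathcal P^{(\alpha,\beta-1)}_{n-1}(x)$ equals $(x+1)\,\mathcal P^{(\alpha,\beta)}_{n-1}(x)$. (iii) For all $n\ge2$, $$P^{QG}_{n+1}(x;-1)=(x-c^{qg}_{n+1})P^{QG}_n(x;-1)-\lambda^{qg}_{n+1}P^{QG}_{n-1}(x;-1),$$ where $$\lambda^{qg}_{n+1}=\frac{4(n-1)(n+\alpha-1)(n+\beta-1)(n+\alpha+\beta-1)}{(2n+\alpha+\beta-2)^2(2n+\alpha+\beta-1)(2n+\alpha+\beta-3)},\qquad c^{qg}_{n+1}=\frac{\beta^2-\alpha^2}{(2n+\alpha+\beta)(2n+\alpha+\beta-2)} .$$ (iv) The polynomials $P^{QG}_n(x;-1)$, $n\ge2$, are orthogonal with respect to $d\mu(x)=(1-x)^{\alpha}(1+x)^{\beta-2}\,dx$ on $(-1,1)$.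
   Context: For $a,b>-1$, $\mathcal P^{(a,b)}_n(x)$ denotes the monic Jacobi polynomial of degree $n$, i.e. the monic polynomials orthogonal on $(-1,1)$ with respect to the weight $(1-x)^a(1+x)^b$. The polynomials $\mathcal P^{(\alpha,\beta-1)}_n$ (the Geronimus transform at $-1$ of $\mathcal P^{(\alpha,\beta)}_n$, for $\alpha>-1$, $\beta>0$) satisfy $\mathcal P^{(\alpha,\beta-1)}_{n+1}(x)=(x-c^g_{n+1})\mathcal P^{(\alpha,\beta-1)}_n(x)-\lambda^g_{n+1}\mathcal P^{(\alpha,\beta-1)}_{n-1}(x)$ for $n\ge1$ with $$\lambda^g_{n+1}=\frac{4n(n+\alpha)(n+\beta-1)(n+\alpha+\beta-1)}{(2n+\alpha+\beta-1)^2(2n+\alpha+\beta)(2n+\alpha+\beta-2)},\qquad c^g_{n+1}=\frac{(\beta-1)^2-\alpha^2}{(2n+\alpha+\beta-1)(2n+\alpha+\beta+1)} .$$ Convention: for $n=1$ the common factor $\alpha+\beta$ in the numerator and denominator of $\chi_1$ and of $\lambda^g_2$ is cancelled (this matters only when $\alpha+\beta=0$). A family of polynomials $(p_n)_{n\ge n_0}$ is orthogonal with respect to a measure $\mu$ if $\int p_np_m\,d\mu$ converges absolutely for all $n,m\ge n_0$, is $0$ for $n\ne m$ and is nonzero for $n=m$. *)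

(* Defs.v *)
From HB Require Import structures.
From mathcomp Require Import all_boot all_order all_algebra.
From mathcomp Require Import all_classical all_reals all_analysis.

Set Implicit Arguments.
Unset Strict Implicit.
Unset Printing Implicit Defensive.

Import Order.TTheory GRing.Theory Num.Theory.
Import numFieldNormedType.Exports.

Local Open Scope classical_set_scope.
Local Open Scope ring_scope.

Definition jacobi_weight (R : realType) (a b : R) : R -> R :=
  fun x => (1 - x) `^ a * (1 + x) `^ b.

(* Orthogonality of [(p n)_(n >= n0)] with respect to [dmu = w(x) dx] on       *)
(* [(-1, 1)]. Integrability is absolute convergence; it has to be required     *)
(* separately because the integral operator is total. [mu] may be infinite.    *)
Definition orthogonal_from (R : realType) (w : R -> R) (n0 : nat)
    (p : nat -> {poly R}) : Prop :=
  forall n m : nat, (n0 <= n)%N -> (n0 <= m)%N ->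
    let f := fun x : R => (p n).[x] * (p m).[x] * w x in
    [/\ lebesgue_measure.-integrable `]-1, 1[ (EFin \o f),
        n <> m -> \int[lebesgue_measure]_(x in `]-1, 1[) f x = 0
      & n = m -> \int[lebesgue_measure]_(x in `]-1, 1[) f x <> 0].

Definition is_monic_jacobi (R : realType) (a b : R) (p : nat -> {poly R}) : Prop :=
  (forall n, p n \is monic /\ size (p n) = n.+1) /\
  orthogonal_from (jacobi_weight a b) 0 p.

(* The monic Jacobi polynomials, as the (unique, for [a, b > -1]) family       *)
(* singled out by [is_monic_jacobi]; the zero family is the fallback value of  *)
(* the description operator when there is no such family.                      *)
Definition jacobi (R : realType) (a b : R) : nat -> {poly R} :=
  xget (fun=> 0) [set p : nat -> {poly R} | is_monic_jacobi a b p].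

(* The recurrence coefficients are indexed by their subscript [k = n.+1], while *)
(* the closed forms are written in terms of [n].                               *)

(* For [k = 2] the factor [alpha + beta], which may vanish, is cancelled.      *)
Definition lambda_g (R : realType) (alpha beta : R) (k : nat) : R :=
  let n : R := k.-1%:R in
  if k == 2%N then
    4 * (1 + alpha) * beta
      / ((alpha + beta + 1) ^+ 2 * (alpha + beta + 2))
  else
    4 * n * (n + alpha) * (n + beta - 1) * (n + alpha + beta - 1)
      / ((2 * n + alpha + beta - 1) ^+ 2
         * (2 * n + alpha + beta) * (2 * n + alpha + beta - 2)).

Definition c_g (R : realType) (alpha beta : R) (k : nat) : R :=
  let n : R := k.-1%:R in
  ((beta - 1) ^+ 2 - alpha ^+ 2)
    / ((2 * n + alpha + beta - 1) * (2 * n + alpha + beta + 1)).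

(* For [n = 1] the factor [alpha + beta], which may vanish, is cancelled.      *)
Definition chi (R : realType) (alpha beta : R) (n : nat) : R :=
  if n == 1%N then 2 * beta / (alpha + beta + 1)
  else
    2 * (beta + n%:R - 1) * (n%:R + alpha + beta - 1)
      / ((2 * n%:R + alpha + beta - 1) * (2 * n%:R + alpha + beta - 2)).

Definition lambda_qg (R : realType) (alpha beta : R) (k : nat) : R :=
  let n : R := k.-1%:R in
  4 * (n - 1) * (n + alpha - 1) * (n + beta - 1) * (n + alpha + beta - 1)
    / ((2 * n + alpha + beta - 2) ^+ 2
       * (2 * n + alpha + beta - 1) * (2 * n + alpha + beta - 3)).

Definition c_qg (R : realType) (alpha beta : R) (k : nat) : R :=
  let n : R := k.-1%:R in
  (beta ^+ 2 - alpha ^+ 2)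
    / ((2 * n + alpha + beta) * (2 * n + alpha + beta - 2)).

(* The quasi-Geronimus Jacobi polynomial at [-1]; meaningful for [n >= 1].     *)
Definition quasi_geronimus_jacobi (R : realType) (alpha beta : R) (n : nat) :
    {poly R} :=
  jacobi alpha (beta - 1) n + chi alpha beta n *: jacobi alpha (beta - 1) n.-1.

(* Main.v *)
Require Import Defs.
From HB Require Import structures.
From mathcomp Require Import all_boot all_order all_algebra.
From mathcomp Require Import all_classical all_reals all_analysis.
From mathcomp Require Import ring lra measurable_realfun.

Set Implicit Arguments.
Unset Strict Implicit.
Unset Printing Implicit Defensive.

Import Order.TTheory GRing.Theory Num.Theory.
Import numFieldNormedType.Exports.

Local Open Scope classical_set_scope.
Local Open Scope ring_scope.

(** In the variable [y = x + 1] the weight [(1 - x)^a (1 + x)^b] becomes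
    [(2 - y)^a y^b] on [(0, 2)], and multiplying the weight by [y] raises [b] by
    one. If [L] is the functional attached to [(alpha, beta - 1)], the functional
    attached to [(alpha, beta)] is therefore [q |-> L (y q)]. Hence
    [y P_(n-1)^(alpha, beta)] is monic of degree [n] and [L]-orthogonal to all
    polynomials of degree less than [n - 1], so it differs from
    [P_n^(alpha, beta - 1)] by a multiple of [P_(n-1)^(alpha, beta - 1)] only
    ([mo_christoffel]). The factor is read off the subleading coefficients, and
    it is [chi] ([shifted_jacobi_geronimus]); this is (ii). Multiplying the
    three-term recurrence of [P^(alpha, beta)] by [x + 1] gives (iii), and (iv)
    is the orthogonality of [P^(alpha, beta)], because the square of [x + 1]
    turns the exponent [beta - 2] into [beta]. Part (i) is an identity between
    rational functions.

    The definition of the Jacobi polynomials is implicit, so their existence,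
    uniqueness and leading coefficients have to be established. The input from
    analysis consists of two facts about
    [L q = int q(1 + x) (1 - x)^a (1 + x)^b dx] for [a, b > -1]. It is positive
    definite ([jacobi_functional_positive]), and it satisfies the Pearson
    equation ([jacobi_functional_pearson]), which says that the integral of the
    derivative of [(1 - x)^(a + 1) (1 + x)^(b + 1) q(1 + x)] vanishes. Everything
    else is algebra. The Pearson equation makes the hypergeometric operator
    [jacobi_op] symmetric for [L]; the explicit polynomials [shifted_jacobi] are
    eigenvectors of it with distinct eigenvalues, hence orthogonal
    ([shifted_jacobi_orthogonal]); and positivity makes the monic orthogonal
    family unique ([mo_unique]). So the Jacobi polynomials are the explicit ones
    shifted by one ([jacobiE]). *)

(** * Monic orthogonal families of a positive functional *)

Lemma size_subr_lead (R : nzRingType) (n : nat) (p q : {poly R}) :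
  (size p <= n.+1)%N -> (size q <= n.+1)%N -> p`_n = q`_n ->
  (size (p - q)%R <= n)%N.
Proof.
move=> sp sq pq; apply/leq_sizeP => j; rewrite leq_eqVlt coefB.
move=> /predU1P[<-|nj]; first by rewrite pq subrr.
by rewrite !nth_default ?subrr // ?(leq_trans sp) ?(leq_trans sq).
Qed.

Section OrthogonalFamilies.
Variable R : realFieldType.
Implicit Types (L : {poly R} -> R) (P Q : nat -> {poly R}).

Record positive_functional L : Prop := PositiveFunctional {
  pos_linear : forall c p q, L (c *: p + q) = c * L p + L q;
  pos_definite : forall p, p != 0 -> 0 < L (p * p) }.

Record monic_orthogonal L P : Prop := MonicOrthogonal {
  mo_monic : forall n, P n \is monic;
  mo_size : forall n, size (P n) = n.+1;
  mo_orth : forall n m, n <> m -> L (P n * P m) = 0 }.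

Lemma mo_coef L P : monic_orthogonal L P -> forall n, (P n)`_n = 1.
Proof.
by move=> PL n; have /monicP := mo_monic PL n; rewrite lead_coefE (mo_size PL).
Qed.

Section Functional.
Variables (L : {poly R} -> R) (Lpos : positive_functional L).

Lemma functional0 : L 0 = 0.
Proof.
by have := pos_linear Lpos 1 0 0; rewrite scaler0 addr0 mul1r => H; lra.
Qed.

Lemma functionalD p q : L (p + q) = L p + L q.
Proof. by have := pos_linear Lpos 1 p q; rewrite scale1r mul1r. Qed.

Lemma functionalZ c p : L (c *: p) = c * L p.
Proof. by have := pos_linear Lpos c p 0; rewrite functional0 !addr0. Qed.

Lemma functionalB p q : L (p - q) = L p - L q.
Proof. by rewrite functionalD -scaleN1r functionalZ mulN1r. Qed.

Lemma functional_sqr_eq0 p : L (p * p) = 0 -> p = 0.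
Proof.
move=> Lp0; apply/eqP; apply: contraT => /(pos_definite Lpos).
by rewrite Lp0 ltxx.
Qed.

Section Family.
Variables (P : nat -> {poly R}) (PL : monic_orthogonal L P).

Lemma size_scale_mo c n : (size (c *: P n) <= n.+1)%N.
Proof. by rewrite (leq_trans (size_scale_leq _ _)) // (mo_size PL). Qed.

(** [P 0], ..., [P k.-1] span the polynomials of size at most [k]; the induction
    peels off the top coefficient. *)
Lemma mo_orth_low n (r : {poly R}) : (size r <= n)%N -> L (P n * r) = 0.
Proof.
suff H k : (k <= n)%N -> forall r : {poly R}, (size r <= k)%N -> L (P n * r) = 0.
  exact: H.
elim: k => [_ q|k IHk kn q sq].
  by rewrite leqn0 size_poly_eq0 => /eqP ->; rewrite mulr0 functional0.
have {}sq : (size (q - q`_k *: P k)%R <= k)%N.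
  apply: size_subr_lead; rewrite ?size_scale_mo //.
  by rewrite coefZ (mo_coef PL) mulr1.
rewrite -(subrK (q`_k *: P k) q) mulrDr functionalD IHk ?(ltnW kn) //.
rewrite -scalerAr functionalZ (mo_orth PL) ?mulr0 ?addr0 //.
by move=> nk; rewrite nk ltnn in kn.
Qed.

(** The difference of the two sides has degree less than [n], so it is orthogonal
    to itself. *)
Lemma mo_proportional n (q : {poly R}) : (size q <= n.+1)%N ->
  (forall r : {poly R}, (size r <= n)%N -> L (q * r) = 0) -> q = q`_n *: P n.
Proof.
move=> sq qr; apply/eqP; rewrite -subr_eq0; apply/eqP.
have sd : (size (q - q`_n *: P n)%R <= n)%N.
  apply: size_subr_lead; rewrite ?size_scale_mo //.
  by rewrite coefZ (mo_coef PL) mulr1.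
apply: functional_sqr_eq0; rewrite {1}mulrBl functionalB qr // -scalerAl.
by rewrite functionalZ mo_orth_low // mulr0 subrr.
Qed.

(** The three-term recurrence, with its coefficients expressed through the
    coefficients of the [P n], which are explicit in the application. *)
Lemma mo_three_term n :
  let r := 'X * P n.+1 - P n.+2 in
  let r' := r - r`_n.+1 *: P n.+1 in
  r' = r'`_n *: P n.
Proof.
move=> r r'.
have sX m : size ('X * P m) = m.+2.
  by rewrite mulrC size_mulX ?(mo_size PL) // monic_neq0 // (mo_monic PL).
have sr : (size r <= n.+2)%N.
  apply: size_subr_lead; rewrite ?sX ?(mo_size PL) //.
  by rewrite coefXM /= !(mo_coef PL).
apply: mo_proportional => [|q sq].
  apply: size_subr_lead; rewrite ?size_scale_mo //.
  by rewrite coefZ (mo_coef PL) mulr1.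
have sXq : (size ('X * q)%R <= n.+1)%N.
  by rewrite (leq_trans (size_polyMleq _ _)) // size_polyX.
rewrite !mulrBl !functionalB -scalerAl functionalZ.
have -> : 'X * P n.+1 * q = P n.+1 * ('X * q) by rewrite mulrCA mulrA.
by rewrite !mo_orth_low ?mulr0 ?subrr // ?(leq_trans sq) // leqW.
Qed.

End Family.

Lemma mo_unique P Q :
  monic_orthogonal L P -> monic_orthogonal L Q -> P =1 Q.
Proof.
move=> PL QL n; apply/eqP; rewrite -subr_eq0; apply/eqP.
have sd : (size (P n - Q n)%R <= n)%N.
  apply: size_subr_lead; rewrite ?(mo_size PL) ?(mo_size QL) //.
  by rewrite (mo_coef PL) (mo_coef QL).
apply: functional_sqr_eq0; rewrite {1}mulrBl functionalB.
by rewrite (mo_orth_low PL) // (mo_orth_low QL) // subrr.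
Qed.

End Functional.

(** The functional [L'] is the Christoffel transform of [L] at [0], and [L] is a
    Geronimus transform of [L']: against a polynomial of degree less than [n],
    ['X * Q n] has the same [L]-value as [Q n] has for [L']. *)
Lemma mo_christoffel L L' P Q :
  positive_functional L -> positive_functional L' ->
  (forall p, L' p = L ('X * p)) ->
  monic_orthogonal L P -> monic_orthogonal L' Q ->
  forall n, 'X * Q n - P n.+1 = ('X * Q n - P n.+1)`_n *: P n.
Proof.
move=> Lpos L'pos LL' PL QL n; apply: (mo_proportional Lpos PL) => [|r sr].
  apply: size_subr_lead; rewrite ?(mo_size PL) //.
  - by rewrite mulrC size_mulX ?(mo_size QL) // monic_neq0 // (mo_monic QL).
  - by rewrite coefXM /= (mo_coef PL) (mo_coef QL).
rewrite mulrBl (functionalB Lpos) -mulrA -LL'.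
rewrite (mo_orth_low L'pos QL) // (mo_orth_low Lpos PL) ?subrr //.
exact: leqW.
Qed.

End OrthogonalFamilies.

(** * Explicit Jacobi polynomials in the variable [1 + x] *)

Section ExplicitJacobi.
Variable R : realFieldType.
Variables a b : R.

(** The product solves the two-term recursion [jacobi_coef_rec], which is the
    hypergeometric differential equation read coefficientwise. For [a, b > -1]
    no denominator vanishes: [j < n] forces [n >= 1], and [a + b > -2]. *)
Definition jacobi_coef (n k : nat) : R :=
  \prod_(k <= j < n)
    (- 2 * (j%:R + 1) * (j%:R + b + 1)
      / ((n%:R - j%:R) * (n%:R + j%:R + a + b + 1))).

Definition shifted_jacobi (n : nat) : {poly R} := \poly_(k < n.+1) jacobi_coef n k.

(** With [y = 1 + x], the derivative of
    [(1 - x)^(a + 1) (1 + x)^(b + 1) p(y)] is the weight [(1 - x)^a (1 + x)^b]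
    times the value at [y] of this polynomial. *)
Definition pearson_op (p : {poly R}) : {poly R} :=
  'X * (2%:P - 'X) * p^`() + ((2 * (b + 1))%:P - (a + b + 2) *: 'X) * p.

Definition pearson (L : {poly R} -> R) : Prop := forall p, L (pearson_op p) = 0.

(** The Jacobi differential operator
    [(1 - x^2) D^2 + (b - a - (a + b + 2) x) D] in the variable [1 + x]. *)
Definition jacobi_op (p : {poly R}) : {poly R} := pearson_op p^`().

(** Integration by parts: both sides are [- L (y (2 - y) p' q')], by the Pearson
    equation at [p q'] and at [q p']. *)
Lemma jacobi_op_symmetric L : positive_functional L -> pearson L ->
  forall p q, L (p * jacobi_op q) = L (q * jacobi_op p).
Proof.
move=> Lpos Lpear p q.
have H u v : L (u * jacobi_op v) = - L ('X * (2%:P - 'X) * u^`() * v^`()).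
  apply/eqP; rewrite -subr_eq0 opprK -(functionalD Lpos) -{}(Lpear (u * v^`())).
  rewrite /jacobi_op /pearson_op derivM; apply/eqP; congr L; ring.
by rewrite !H; congr (- L _); ring.
Qed.

Lemma jacobi_coef_diag n : jacobi_coef n n = 1.
Proof. by rewrite /jacobi_coef big_geq. Qed.

Lemma jacobi_coef_rec n k : -1 < a -> -1 < b -> (k < n)%N ->
  (n%:R - k%:R) * (n%:R + k%:R + a + b + 1) * jacobi_coef n k
  = - 2 * (k%:R + 1) * (k%:R + b + 1) * jacobi_coef n k.+1.
Proof.
move=> ha hb kn; rewrite /jacobi_coef big_ltn // mulrA.
have n1 : 1 <= n%:R :> R by rewrite ler1n (leq_trans _ kn).
have k0 : 0 <= k%:R :> R by rewrite ler0n.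
have kn' : k%:R < n%:R :> R by rewrite ltr_nat.
congr (_ * _); move: (n%:R : R) (k%:R : R) n1 k0 kn' => x y x1 y0 xy.
by field; apply/andP; split; rewrite gt_eqF //; lra.
Qed.

Lemma coef_shifted_jacobi n k :
  (shifted_jacobi n)`_k = if (k < n.+1)%N then jacobi_coef n k else 0.
Proof. by rewrite coef_poly. Qed.

Lemma size_shifted_jacobi n : size (shifted_jacobi n) = n.+1.
Proof. by rewrite size_poly_eq // jacobi_coef_diag oner_eq0. Qed.

Lemma monic_shifted_jacobi n : shifted_jacobi n \is monic.
Proof.
by rewrite monicE lead_coefE size_shifted_jacobi coef_shifted_jacobi ltnSn
  jacobi_coef_diag.
Qed.

Lemma coef_jacobi_op p k :
  (jacobi_op p)`_k = 2 * (k%:R + 1) * (k%:R + b + 1) * p`_k.+1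
                     - k%:R * (k%:R + a + b + 1) * p`_k.
Proof.
have -> : jacobi_op p = 2 *: ('X * p^`()^`()) - 'X * ('X * p^`()^`())
    + (2 * (b + 1)) *: p^`() - (a + b + 2) *: ('X * p^`()).
  by rewrite /jacobi_op /pearson_op -!mul_polyC; ring.
rewrite !(coefD, coefN, coefZ, coefXM, coef_deriv).
case: k => [|[|k]] /=; ring.
Qed.

Lemma jacobi_op_eigen n : -1 < a -> -1 < b ->
  jacobi_op (shifted_jacobi n)
  = - (n%:R * (n%:R + a + b + 1)) *: shifted_jacobi n.
Proof.
move=> ha hb; apply/polyP => k; rewrite coef_jacobi_op coefZ !coef_shifted_jacobi !ltnS.
case: (ltngtP k n) => [kn|kn|->].
- by have := jacobi_coef_rec ha hb kn => H; lra.
- by rewrite !mulr0 subrr.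
- ring.
Qed.

(** The eigenvalues of indices [n] and [m] differ by
    [(n - m) (n + m + a + b + 1)], which is nonzero for [n <> m], since then
    [n + m >= 1]. *)
Lemma shifted_jacobi_orthogonal L : -1 < a -> -1 < b ->
  positive_functional L -> pearson L ->
  monic_orthogonal L shifted_jacobi.
Proof.
move=> ha hb Lpos Lpear; split; [exact: monic_shifted_jacobi
  |exact: size_shifted_jacobi|move=> n m nm].
have := jacobi_op_symmetric Lpos Lpear (shifted_jacobi n) (shifted_jacobi m).
rewrite !jacobi_op_eigen // -!scalerAr !(functionalZ Lpos) [_ n * _ m]mulrC.
set l := L _ => H.
have {}H : (n%:R - m%:R) * (n%:R + m%:R + a + b + 1) * l = 0 by lra.
have nm0 : n%:R - m%:R != 0 :> R by rewrite subr_eq0 eqr_nat; apply/eqP.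
have nm1 : 1 <= n%:R + m%:R :> R.
  by rewrite -natrD ler1n; case: n m nm {H nm0 l} => [|n] [|m].
apply/eqP; move/eqP: H; rewrite !mulf_eq0 (negbTE nm0) /=.
by case/orP => // /eqP H; clear nm; lra.
Qed.

Lemma jacobi_coef_sub1 n : -1 < a -> -1 < b ->
  jacobi_coef n.+1 n
  = - 2 * (n%:R + 1) * (n%:R + b + 1) / (2 * n%:R + a + b + 2).
Proof.
move=> ha hb; have n0 : 0 <= n%:R :> R by rewrite ler0n.
rewrite /jacobi_coef big_nat1 -[n.+1%:R]natr1; move: (n%:R : R) n0 => x x0; field.
by do ?[apply/andP; split]; rewrite gt_eqF //; lra.
Qed.

Lemma jacobi_coef_sub2 n : -1 < a -> -1 < b ->
  jacobi_coef n.+2 n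
  = 2 * (n%:R + 1) * (n%:R + 2) * (n%:R + b + 1) * (n%:R + b + 2)
    / ((2 * n%:R + a + b + 3) * (2 * n%:R + a + b + 4)).
Proof.
move=> ha hb; have n0 : 0 <= n%:R :> R by rewrite ler0n.
rewrite /jacobi_coef big_ltn // big_nat1 -[n.+2%:R]natr1 -[n.+1%:R]natr1;
  move: (n%:R : R) n0 => x x0.
field.
by do ?[apply/andP; split]; rewrite gt_eqF //; lra.
Qed.

End ExplicitJacobi.

(** * Improper integrals of derivatives *)

Section ImproperFTC.
Variable R : realType.
Notation mu := (@lebesgue_measure R).
Implicit Types (f F g G : R -> R) (a b la lb : R).

Lemma is_derive_continuous F (x dF : R) :
  is_derive x 1 F dF -> {for x, continuous F}.
Proof. by case=> dFx _; exact/differentiable_continuous/derivable1_diffP. Qed.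

(** [f] may be unbounded at both ends. The open interval is exhausted by the
    segments [K n], on which the fundamental theorem applies, and monotone
    convergence gives the limit. *)
Lemma ge0_improper_FTC2 f F a b la lb : a < b ->
  {in `]a, b[, continuous f} ->
  (forall x, x \in `]a, b[ -> is_derive x 1 F (f x)) ->
  F x @[x --> a^'+] --> la -> F x @[x --> b^'-] --> lb ->
  (forall x, x \in `]a, b[ -> 0 <= f x) ->
  (\int[mu]_(x in `]a, b[) (f x)%:E = (lb - la)%:E)%E.
Proof.
move=> ab cf dF Fa Fb f0.
have cF : {in `]a, b[, continuous F}.
  by move=> x /dF; exact: is_derive_continuous.
(* With a denominator of at least 3 the segments are nondegenerate. *)
pose e (n : nat) : R := (b - a) / n.+3%:R.
have e0 n : 0 < e n by rewrite divr_gt0 ?subr_gt0.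
have e_lt n : a + e n < b - e n.
  rewrite ltrBrDr -addrA -mulr2n -mulr_natr -ltrBrDl /e mulrAC.
  rewrite ltr_pdivrMr // ltr_pM2l ?subr_gt0 // ltr_nat //.
have e_dec : {homo e : n m / (n <= m)%N >-> m <= n}.
  move=> n m nm; rewrite ler_pM2l ?subr_gt0 // lef_pV2 ?posrE //.
  by rewrite ler_nat.
have e_cvg : e n @[n --> \oo] --> 0.
  rewrite -[X in _ --> X](mulr0 (b - a)); apply: cvgM; first exact: cvg_cst.
  have := @cvg_harmonic R; rewrite -(cvg_shiftn 2) /harmonic.
  by under eq_fun do rewrite addn2.
pose K n := `[a + e n, b - e n]%classic.
have KE : `]a, b[%classic = \bigcup_n K n.
  apply/seteqP; split => [x /= | x [n _] /=]; rewrite /K /= !in_itv /=.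
    move=> /andP[ax xb].
    have d0 : 0 < Num.min (x - a) (b - x) by rewrite lt_min !subr_gt0 ax.
    have /cvgrPdist_lt/(_ _ d0) [n _ /(_ n (leqnn n))] := e_cvg.
    rewrite /= sub0r normrN gtr0_norm // lt_min => /andP[en1 en2].
    exists n; rewrite // /K /= in_itv /=; apply/andP; split; lra.
  by move=> /andP[h1 h2]; have := e0 n => h3; apply/andP; split; lra.
have subK n x : x \in `[a + e n, b - e n] -> x \in `]a, b[.
  rewrite !in_itv /= => /andP[h1 h2]; have := e0 n => h3.
  by apply/andP; split; lra.
have mf : measurable_fun `]a, b[ f.
  apply: open_continuous_measurable_fun => //.
  by move=> x; rewrite inE => xab; apply: cf.
have intK n : (\int[mu]_(x in K n) (f x)%:E = (F (b - e n) - F (a + e n))%:E)%E.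
  have Kcont (h : R -> R) : {in `]a, b[, continuous h} ->
      {within `[a + e n, b - e n], continuous h}.
    move=> ch; apply: continuous_in_subspaceT => x.
    by rewrite inE => /subK; exact: ch.
  rewrite (@continuous_FTC2 _ f F) -?EFinB //.
  - exact: Kcont.
  - have [_ cl cr] := (continuous_within_itvP F (e_lt n)).1 (Kcont _ cF).
    split => // x xe; have := dF x; case => //.
    by apply: (subK n); apply: subset_itv_oo_cc.
  - move=> x xe; rewrite derive1E; have := dF x; case => //.
    by apply: (subK n); apply: subset_itv_oo_cc.
have int_cvg : (\int[mu]_(x in K n) (f x)%:E @[n --> \oo] -->
    \int[mu]_(x in `]a, b[) (f x)%:E)%E.
  rewrite KE; apply: ge0_nondecreasing_set_cvg_integral => //.
  - move=> n m nm; apply/subsetPset => x; rewrite /K /= !in_itv /=.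
    by have := e_dec _ _ nm => h /andP[h1 h2]; apply/andP; split; lra.
  - by move=> n; exact: measurable_itv.
  - move=> n; apply/measurable_EFinP; apply: measurable_funS mf => //.
    by move=> x /=; exact: subK.
  - by move=> n x /= /subK /f0; rewrite lee_fin.
have {int_cvg} := int_cvg; under eq_fun do rewrite intK.
move=> int_cvg; apply: (cvg_unique _ int_cvg) => //.
apply: cvg_EFin; first exact: nearW.
apply: cvgB.
- apply: (cvg_at_leftP _ _ _).1 Fb _ _; split=> [n|]; first by rewrite gtrBl.
  by rewrite -[X in _ --> X]subr0; apply: cvgB => //; exact: cvg_cst.
- apply: (cvg_at_rightP _ _ _).1 Fa _ _; split=> [n|]; first by rewrite ltrDl.
  by rewrite -[X in _ --> X]addr0; apply: cvgD => //; exact: cvg_cst.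
Qed.

(** Both [g] and [f + g] are nonnegative with known primitives, so the
    nonnegative case applies to each of them and [f] is their difference. *)
Lemma dominated_improper_FTC2 f F g G a b la lb (la' lb' : R) : a < b ->
  {in `]a, b[, continuous f} -> {in `]a, b[, continuous g} ->
  (forall x, x \in `]a, b[ -> is_derive x 1 F (f x)) ->
  (forall x, x \in `]a, b[ -> is_derive x 1 G (g x)) ->
  F x @[x --> a^'+] --> la -> F x @[x --> b^'-] --> lb ->
  G x @[x --> a^'+] --> la' -> G x @[x --> b^'-] --> lb' ->
  (forall x, x \in `]a, b[ -> `|f x| <= g x) ->
  mu.-integrable `]a, b[ (EFin \o f) /\
  \int[mu]_(x in `]a, b[) f x = lb - la.
Proof.
move=> ab cf cg dF dG Fa Fb Ga Gb fg.
have mfun (h : R -> R) : {in `]a, b[, continuous h} -> measurable_fun `]a, b[ h.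
  move=> ch; apply: open_continuous_measurable_fun => //.
  by move=> x; rewrite inE => xab; apply: ch.
have g0 x : x \in `]a, b[ -> 0 <= g x by move=> /fg; exact: le_trans (normr_ge0 _).
have intg := ge0_improper_FTC2 ab cg dG Ga Gb g0.
have ig : mu.-integrable `]a, b[ (EFin \o g).
  apply/integrableP; split; first by apply/measurable_EFinP; exact: mfun.
  have -> : (\int[mu]_(x in `]a, b[) `|(EFin \o g) x|
      = \int[mu]_(x in `]a, b[) (g x)%:E)%E.
    by apply: eq_integral => x; rewrite inE => /g0 gx; rewrite /= ger0_norm.
  by rewrite intg ltry.
have intf : mu.-integrable `]a, b[ (EFin \o f).
  apply: le_integrable ig => //; first by apply/measurable_EFinP; exact: mfun.
  by move=> x /= /[dup] /g0 gx /fg; rewrite lee_fin (ger0_norm gx).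
split=> //.
have intfg : (\int[mu]_(x in `]a, b[) (f x + g x)%:E
    = (lb + lb' - (la + la'))%:E)%E.
  apply: (@ge0_improper_FTC2 (fun x => f x + g x) (fun x => F x + G x)) => //.
  - by move=> x xab; apply: cvgD; [exact: cf|exact: cg].
  - move=> x xab; apply: is_deriveD; [exact: dF|exact: dG].
  - exact: cvgD.
  - exact: cvgD.
  - by move=> x /fg; rewrite ler_norml => /andP[]; lra.
have : \int[mu]_(x in `]a, b[) (f x + g x) = lb + lb' - (la + la').
  by rewrite /Rintegral intfg.
rewrite RintegralD // [X in _ + X]/Rintegral intg /= => H.
by apply: (addIr (lb' - la')); rewrite H; ring.
Qed.

End ImproperFTC.

(** * The functional of the Jacobi weight *)

Section JacobiFunctional.
Variable R : realType.
Notation mu := (@lebesgue_measure R).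
Implicit Types (a b c x : R) (q : {poly R}).

Lemma powR_addr1 c x : 0 < x -> x `^ (c + 1) = x * x `^ c.
Proof.
move=> x0; rewrite addrC powRD; first by rewrite powRr1 // ltW.
by rewrite (gt_eqF x0) implybT.
Qed.

Lemma is_derive_powR_sub1 c x : x < 1 ->
  is_derive x 1 (fun y : R => (1 - y) `^ c) (- (c * (1 - x) `^ (c - 1))).
Proof.
move=> x1; have x0 : 0 < 1 - x by rewrite subr_gt0.
have d1 := is_derive1_powR c x0.
have d2 : is_derive x 1 (fun y : R => 1 - y) (- 1).
  by rewrite -[- 1]add0r; apply: is_deriveB.
by have := @is_derive1_comp _ (fun y => y `^ c) (fun y => 1 - y) _ _ _ d1 d2;
  rewrite mulrN1.
Qed.

Lemma is_derive_powR_add1 c x : -1 < x ->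
  is_derive x 1 (fun y : R => (1 + y) `^ c) (c * (1 + x) `^ (c - 1)).
Proof.
move=> x1; have x0 : 0 < 1 + x by lra.
have d1 := is_derive1_powR c x0.
have d2 : is_derive x 1 (fun y : R => 1 + y) 1.
  by rewrite -[X in is_derive _ _ _ X]add0r; apply: is_deriveD.
by have := @is_derive1_comp _ (fun y => y `^ c) (fun y => 1 + y) _ _ _ d1 d2;
  rewrite mulr1.
Qed.

Lemma cvg_powR_add1_right c : 0 < c -> (1 + x) `^ c @[x --> (-1)^'+] --> (0 : R).
Proof.
move=> c0; apply/cvg_at_rightP => u [u1 ucvg].
apply: ((cvg_at_rightP (fun y : R => y `^ c) 0 0).1 (powR_cvg0 c0)
  (fun n => 1 + u n)).
split=> [n|]; first by have := u1 n; lra.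
by rewrite -[X in _ --> X](subrr (1 : R)); apply: cvgD => //; exact: cvg_cst.
Qed.

Lemma cvg_powR_sub1_left c : 0 < c -> (1 - x) `^ c @[x --> 1^'-] --> (0 : R).
Proof.
move=> c0; apply/cvg_at_leftP => u [u1 ucvg].
apply: ((cvg_at_rightP (fun y : R => y `^ c) 0 0).1 (powR_cvg0 c0)
  (fun n => 1 - u n)).
split=> [n|]; first by rewrite subr_gt0.
by rewrite -[X in _ --> X](subrr (1 : R)); apply: cvgB => //; exact: cvg_cst.
Qed.

Lemma cvg_powR_sub1_right c :
  (1 - x) `^ c @[x --> (-1)^'+] --> ((1 - (- 1)) `^ c : R).
Proof.
apply: cvg_at_right_filter.
by apply: (is_derive_continuous (is_derive_powR_sub1 c _)); lra.
Qed.

Lemma cvg_powR_add1_left c :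
  (1 + x) `^ c @[x --> 1^'-] --> ((1 + 1) `^ c : R).
Proof.
apply: cvg_at_left_filter.
by apply: (is_derive_continuous (is_derive_powR_add1 c _)); lra.
Qed.

Lemma continuous_horner_add1 q : continuous (fun x : R => q.[x + 1]).
Proof.
move=> x; apply: (@continuous_comp _ _ _ (fun y : R => y + 1) (horner q)).
  by apply: cvgD; [exact: cvg_id|exact: cvg_cst].
exact: continuous_horner.
Qed.

Lemma is_derive_horner_add1 q x :
  is_derive x 1 (fun y : R => q.[y + 1]) (q^`()).[x + 1].
Proof.
have d1 := is_derive_poly q (x + 1).
have d2 : is_derive x 1 (fun y : R => y + 1) 1.
  by rewrite -[X in is_derive _ _ _ X]addr0; apply: is_deriveD.
by have := @is_derive1_comp _ (horner q) (fun y => y + 1) _ _ _ d1 d2;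
  rewrite mulr1.
Qed.

(** The weight has at most one singular factor at each end point, so a polynomial
    multiple of it is bounded by a multiple of the sum of the two factors. Unlike
    the weight, this sum has an elementary primitive. *)
Definition jacobi_bound a b (M : R) x : R := M * ((1 - x) `^ a + (1 + x) `^ b).

Definition jacobi_bound_primitive a b (M : R) x : R :=
  M * (- (a + 1)^-1 * (1 - x) `^ (a + 1) + (b + 1)^-1 * (1 + x) `^ (b + 1)).

Lemma powR_le_12 c x : 1 <= x <= 2 -> x `^ c <= 1 + 2 `^ c.
Proof.
move=> /andP[x1 x2]; have [c0|c0] := leP 0 c.
  by apply: ler_wpDl => //; apply: ge0_ler_powR => //; rewrite nnegrE; lra.
apply: ler_wpDr; first exact: powR_ge0.
by rewrite -[leRHS](powRr0 x) ler_powR // ltW.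
Qed.

Lemma jacobi_weight_bound a b q :
  exists M : R, forall x, x \in `]-1, 1[ ->
    `|q.[x + 1] * jacobi_weight a b x| <= jacobi_bound a b M x.
Proof.
have [N qN] := poly_itv_bound q 0 2.
pose K : R := (1 + 2 `^ a) + (1 + 2 `^ b).
exists (N * K) => x; rewrite in_itv /= => /andP[x1 x2].
have w1 : 0 <= (1 - x) `^ a by exact: powR_ge0.
have w2 : 0 <= (1 + x) `^ b by exact: powR_ge0.
have p1 : 0 <= 2 `^ a :> R by exact: powR_ge0.
have p2 : 0 <= 2 `^ b :> R by exact: powR_ge0.
rewrite normrM /jacobi_bound -mulrA; apply: ler_pM => //.
  by apply: qN; lra.
rewrite ger0_norm ?mulr_ge0 // /jacobi_weight /K.
(* The factor that is bounded on the half of the interval containing [x] has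
   its base in [1, 2]. *)
have [x0|x0] := leP 0 x.
  have := @powR_le_12 b (1 + x); set u := _ `^ b in w2 *; set v := _ `^ a in w1 *.
  move=> H; have {}H : u <= 1 + 2 `^ b by apply: H; lra.
  by move: (2 `^ a) (2 `^ b) p1 p2 H => s t s0 t0 ut; nra.
have := @powR_le_12 a (1 - x); set u := _ `^ b in w2 *; set v := _ `^ a in w1 *.
move=> H; have {}H : v <= 1 + 2 `^ a by apply: H; lra.
by move: (2 `^ a) (2 `^ b) p1 p2 H => s t s0 t0 vs; nra.
Qed.

Lemma continuous_jacobi_weight a b q :
  {in `]-1, 1[, continuous (fun x => q.[x + 1] * jacobi_weight a b x)}.
Proof.
move=> x; rewrite in_itv /= => /andP[x1 x2].
apply: cvgM; first exact: continuous_horner_add1.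
apply: cvgM.
  exact: (is_derive_continuous (is_derive_powR_sub1 a x2)).
exact: (is_derive_continuous (is_derive_powR_add1 b x1)).
Qed.

Lemma continuous_jacobi_bound a b M :
  {in `]-1, 1[, continuous (jacobi_bound a b M)}.
Proof.
move=> x; rewrite in_itv /= => /andP[x1 x2].
apply: cvgM; first exact: cvg_cst.
apply: cvgD.
  exact: (is_derive_continuous (is_derive_powR_sub1 a x2)).
exact: (is_derive_continuous (is_derive_powR_add1 b x1)).
Qed.

Lemma is_derive_jacobi_bound_primitive a b M x : -1 < a -> -1 < b ->
  x \in `]-1, 1[ ->
  is_derive x 1 (jacobi_bound_primitive a b M) (jacobi_bound a b M x).
Proof.
move=> ha hb; rewrite in_itv /= => /andP[x1 x2].
have a0 : a + 1 != 0 by rewrite gt_eqF //; lra.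
have b0 : b + 1 != 0 by rewrite gt_eqF //; lra.
have d1 := is_derive_powR_sub1 (a + 1) x2.
have d2 := is_derive_powR_add1 (b + 1) x1.
have d := is_deriveZ M (is_deriveD (is_deriveZ (- (a + 1)^-1) d1)
  (is_deriveZ (b + 1)^-1 d2)).
apply: (is_derive_eq d).
rewrite /jacobi_bound /GRing.scale /= !addrK.
by field; rewrite a0 b0.
Qed.

Lemma cvg_jacobi_bound_primitive a b M : -1 < a -> -1 < b ->
  jacobi_bound_primitive a b M x @[x --> (-1)^'+] -->
    M * (- (a + 1)^-1 * (1 - (- 1)) `^ (a + 1) + (b + 1)^-1 * 0) /\
  jacobi_bound_primitive a b M x @[x --> 1^'-] -->
    M * (- (a + 1)^-1 * 0 + (b + 1)^-1 * (1 + 1) `^ (b + 1)).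
Proof.
move=> ha hb; have a0 : 0 < a + 1 by lra. have b0 : 0 < b + 1 by lra.
split; (apply: cvgM; first exact: cvg_cst); apply: cvgD;
  (apply: cvgM; first exact: cvg_cst).
- exact: cvg_powR_sub1_right.
- exact: cvg_powR_add1_right.
- exact: cvg_powR_sub1_left.
- exact: cvg_powR_add1_left.
Qed.

Definition pearson_primitive a b q x : R :=
  (1 - x) `^ (a + 1) * (1 + x) `^ (b + 1) * q.[x + 1].

Lemma cvg_pearson_primitive a b q : -1 < a -> -1 < b ->
  pearson_primitive a b q x @[x --> (-1)^'+] --> (0 : R) /\
  pearson_primitive a b q x @[x --> 1^'-] --> (0 : R).
Proof.
move=> ha hb; have a0 : 0 < a + 1 by lra. have b0 : 0 < b + 1 by lra.
split.
  rewrite -[X in _ --> X](mul0r q.[-1 + 1]) -[X in X * _](mulr0 ((1 - (- 1)) `^ (a + 1))).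
  apply: cvgM; first apply: cvgM.
  - exact: cvg_powR_sub1_right.
  - exact: cvg_powR_add1_right.
  - by apply: cvg_at_right_filter; exact: continuous_horner_add1.
rewrite -[X in _ --> X](mul0r q.[1 + 1]) -[X in X * _](mul0r ((1 + 1) `^ (b + 1))).
apply: cvgM; first apply: cvgM.
- exact: cvg_powR_sub1_left.
- exact: cvg_powR_add1_left.
- by apply: cvg_at_left_filter; exact: continuous_horner_add1.
Qed.

Lemma is_derive_pearson_primitive a b q x : x \in `]-1, 1[ ->
  is_derive x 1 (pearson_primitive a b q)
    ((pearson_op a b q).[x + 1] * jacobi_weight a b x).
Proof.
rewrite in_itv /= => /andP[x1 x2].
have d1 := is_derive_powR_sub1 (a + 1) x2.
have d2 := is_derive_powR_add1 (b + 1) x1.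
have d := is_deriveM (is_deriveM d1 d2) (is_derive_horner_add1 q x).
apply: (is_derive_eq d).
rewrite /pearson_op /jacobi_weight /GRing.scale /= fctE !hornerE /= !addrK.
rewrite !powR_addr1 ?subr_gt0 //; last by lra.
ring.
Qed.

Definition jacobi_functional a b q : R :=
  \int[mu]_(x in `]-1, 1[) (q.[x + 1] * jacobi_weight a b x).

Lemma jacobi_functional_integrable a b q : -1 < a -> -1 < b ->
  mu.-integrable `]-1, 1[ (EFin \o (fun x => q.[x + 1] * jacobi_weight a b x)).
Proof.
move=> ha hb; have [M qM] := jacobi_weight_bound a b q.
have M0 : {in `]-1, 1[, forall x, 0 <= jacobi_bound a b M x}.
  by move=> x /qM; exact: le_trans (normr_ge0 _).
have n11 : -1 < 1 :> R by lra.
have [Ga Gb] := cvg_jacobi_bound_primitive M ha hb.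
have dG x := @is_derive_jacobi_bound_primitive a b M x ha hb.
have cg := @continuous_jacobi_bound a b M.
have gg x : x \in `]-1, 1[ -> `|jacobi_bound a b M x| <= jacobi_bound a b M x.
  by move=> xI; rewrite ger0_norm ?M0.
have [ig _] := dominated_improper_FTC2 n11 cg cg dG dG Ga Gb Ga Gb gg.
apply: le_integrable ig => //.
  apply/measurable_EFinP; apply: open_continuous_measurable_fun => //.
  by move=> x; rewrite inE => xI; exact: continuous_jacobi_weight.
by move=> x /= xI; rewrite lee_fin (ger0_norm (M0 x xI)) qM.
Qed.

(** The primitive vanishes at both end points because [a + 1] and [b + 1] are
    positive. *)
Lemma jacobi_functional_pearson a b : -1 < a -> -1 < b ->
  pearson a b (jacobi_functional a b).
Proof.
move=> ha hb q; set q' := pearson_op a b q; have [M qM] := jacobi_weight_bound a b q'.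
have n11 : -1 < 1 :> R by lra.
have [Ga Gb] := cvg_jacobi_bound_primitive M ha hb.
have [Fa Fb] := cvg_pearson_primitive q ha hb.
have dG x := @is_derive_jacobi_bound_primitive a b M x ha hb.
rewrite /jacobi_functional.
have [_ ->] := dominated_improper_FTC2 n11 (@continuous_jacobi_weight a b q')
  (@continuous_jacobi_bound a b M) (@is_derive_pearson_primitive a b q) dG
  Fa Fb Ga Gb qM.
by rewrite subrr.
Qed.

Lemma finite_roots q : q != 0 -> finite_set [set x | root q x].
Proof.
move=> q0; apply: contrapT => /(infinite_set_fset (size q)) [B Bq].
apply/negP; rewrite -ltnNge; apply: max_poly_roots => //.
  by apply/allP => x xB; exact: Bq.
exact: finmap.fset_uniq.
Qed.

(** A square with zero integral vanishes almost everywhere on the interval, so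
    the interval would be covered by a null set and finitely many roots. *)
Lemma jacobi_functional_positive a b : -1 < a -> -1 < b ->
  positive_functional (jacobi_functional a b).
Proof.
move=> ha hb; have int q := jacobi_functional_integrable q ha hb.
split=> [c p q|p p0].
  rewrite /jacobi_functional -RintegralZl // -RintegralD //; last first.
    under [X in _.-integrable _ X]eq_fun do rewrite /= EFinM.
    by apply: integrableZl => //; exact: int.
  by apply: eq_Rintegral => x _; rewrite hornerD hornerZ mulrDl -mulrA.
pose f x := (p * p).[x + 1] * jacobi_weight a b x.
have f0 x : 0 <= f x.
  by rewrite /f hornerM -expr2 mulr_ge0 ?sqr_ge0 // mulr_ge0 ?powR_ge0.
rewrite lt_neqAle Rintegral_ge0 ?andbT; last by move=> x _; exact: f0.
apply/eqP => int0.
have : (\int[mu]_(x in `](-1)%R, 1%R[) `|(EFin \o f) x| = 0)%E.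
  under eq_integral do rewrite /= ger0_norm //.
  rewrite -(@fineK _ (\int[mu]_(x in _) _)%E); first by congr EFin.
  exact: integrable_fin_num (int (p * p)).
have /integrableP[mf _] := int (p * p).
case/(ae_eq_integral_abs _ _ mf) => // N [mN N0 sN].
have sub_roots : `]-1, 1[ `\` N `<=` [set x | root (p \Po ('X + 1%:P)) x].
  move=> x [/= xI /(contra_notP (@sN x)) /= /(_ xI) [] fx0].
  have w0 : jacobi_weight a b x != 0.
    move: xI; rewrite in_itv /= => /andP[x1 x2].
    by rewrite gt_eqF // mulr_gt0 // powR_gt0; lra.
  move/eqP: fx0; rewrite mulf_eq0 (negbTE w0) orbF hornerM mulf_eq0 orbb.
  by rewrite rootE horner_comp !hornerE.
have shift0 : p \Po ('X + 1%:P) != 0.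
  apply: contraNneq p0 => p1.
  by rewrite -(comp_polyXaddC_K p 1) p1 comp_poly0.
pose I : set (measurableTypeR R) := `]-1, 1[%classic.
have mI : measurable I by exact: measurable_itv.
have mZ : measurable (I `\` N) by exact: measurableD.
have Z0 : mu (I `\` N) = 0%E.
  apply: countable_lebesgue_measure0; apply: finite_set_countable.
  exact: sub_finite_set sub_roots (finite_roots shift0).
have U0 : mu (N `|` (I `\` N)) = 0%E by rewrite -N0; exact: measureU0.
have sub_cover : I `<=` N `|` (I `\` N).
  by move=> x xI; have [xN|xN] := pselect (N x); [left|right].
have : (mu I <= mu (N `|` (I `\` N)))%E.
  by rewrite le_measure ?inE //; exact: measurableU.
rewrite U0 /I.
rewrite lebesgue_measure_itv /= lte_fin ifT; last by lra.
by rewrite -EFinB lee_fin; lra.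
Qed.

End JacobiFunctional.

(** * The Jacobi polynomials and their recurrences *)

Section JacobiPolynomials.
Variable R : realType.
Implicit Types (a b c x : R) (p q : {poly R}).

Lemma jacobi_functional_mulX a b q :
  jacobi_functional a (b + 1) q = jacobi_functional a b ('X * q).
Proof.
apply: eq_Rintegral => x; rewrite inE /= in_itv /= => /andP[x1 x2].
rewrite hornerM hornerX /jacobi_weight powR_addr1; last by lra.
by rewrite (addrC 1 x); ring.
Qed.

Lemma size_comp_XaddC p c : size (p \Po ('X + c%:P)) = size p.
Proof. by rewrite size_comp_poly2 // size_XaddC. Qed.

Lemma monic_comp_XaddC p c : p \is monic -> p \Po ('X + c%:P) \is monic.
Proof.
rewrite !monicE lead_coef_comp ?size_XaddC // => /eqP ->.
by rewrite lead_coefXaddC expr1n mulr1.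
Qed.

Lemma jacobi_functional_shift a b p q :
  \int[@lebesgue_measure R]_(x in `]-1, 1[)
     ((p \Po ('X + 1%:P)).[x] * (q \Po ('X + 1%:P)).[x] * jacobi_weight a b x)
  = jacobi_functional a b (p * q).
Proof.
apply: eq_Rintegral => x _.
by rewrite !horner_comp hornerM hornerD hornerX hornerC.
Qed.

Lemma is_monic_jacobi_shift a b (P : nat -> {poly R}) : -1 < a -> -1 < b ->
  is_monic_jacobi a b (fun n => P n \Po ('X + 1%:P)) <->
  monic_orthogonal (jacobi_functional a b) P.
Proof.
move=> ha hb; split=> [[Pmon Porth]|PL].
  have PE n : P n = (P n \Po ('X + 1%:P)) \Po ('X + (- 1)%:P).
    by rewrite polyCN comp_polyXaddC_K.
  split=> [n|n|n m nm].
  - by rewrite PE monic_comp_XaddC //; have [] := Pmon n.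
  - by rewrite PE size_comp_XaddC //; have [] := Pmon n.
  - have /= [_ /(_ nm) + _] := Porth n m isT isT.
    by rewrite jacobi_functional_shift.
split=> [n|n m _ _ f].
  by rewrite monic_comp_XaddC ?(mo_monic PL) // size_comp_XaddC (mo_size PL).
split.
- apply: eq_integrable (jacobi_functional_integrable (P n * P m) ha hb) => //.
  by move=> x _; rewrite /f /= !horner_comp hornerM hornerD hornerX hornerC.
- by move=> nm; rewrite jacobi_functional_shift (mo_orth PL).
- move=> nm; rewrite /f -nm jacobi_functional_shift; apply/eqP; rewrite gt_eqF //.
  apply: (pos_definite (jacobi_functional_positive ha hb)).
  by rewrite monic_neq0 // (mo_monic PL).
Qed.

Lemma shifted_jacobi_functional a b : -1 < a -> -1 < b ->
  monic_orthogonal (jacobi_functional a b) (shifted_jacobi a b).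
Proof.
move=> ha hb; apply: shifted_jacobi_orthogonal => //.
  exact: jacobi_functional_positive.
exact: jacobi_functional_pearson.
Qed.

Lemma jacobiP a b : -1 < a -> -1 < b -> is_monic_jacobi a b (jacobi a b).
Proof.
move=> ha hb; rewrite /jacobi; apply: xgetPex.
exists (fun n => shifted_jacobi a b n \Po ('X + 1%:P)).
by apply/is_monic_jacobi_shift => //; exact: shifted_jacobi_functional.
Qed.

Lemma jacobiE a b n : -1 < a -> -1 < b ->
  jacobi a b n = shifted_jacobi a b n \Po ('X + 1%:P).
Proof.
move=> ha hb; have := jacobiP ha hb; set P := jacobi a b => PJ.
have PE m : P m = (P m \Po ('X - 1%:P)) \Po ('X + 1%:P).
  by have := comp_polyXaddC_K (P m) (- 1); rewrite polyCN opprK.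
have PL : monic_orthogonal (jacobi_functional a b) (fun n => P n \Po ('X - 1%:P)).
  apply/is_monic_jacobi_shift => //.
  by rewrite (_ : (fun n => _) = P) //; apply/funext => m; rewrite -PE.
rewrite PE; congr (_ \Po _).
exact: (mo_unique (jacobi_functional_positive ha hb) PL
  (shifted_jacobi_functional ha hb)).
Qed.

(** The coefficient of [y^n] in the difference of the two monic polynomials of
    degree [n + 1] is [chi]. For [n = 0] the first of them contributes nothing,
    and this is where the cancelled form of the first [chi] comes from. *)
Lemma shifted_jacobi_geronimus (alpha beta : R) n : -1 < alpha -> 0 < beta ->
  'X * shifted_jacobi alpha beta n
  = shifted_jacobi alpha (beta - 1) n.+1
    + chi alpha beta n.+1 *: shifted_jacobi alpha (beta - 1) n.
Proof.
move=> ha hb; have hb0 : -1 < beta by lra. have hb1 : -1 < beta - 1 by lra.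
have LL q : jacobi_functional alpha beta q
    = jacobi_functional alpha (beta - 1) ('X * q).
  by rewrite -jacobi_functional_mulX subrK.
have := mo_christoffel (jacobi_functional_positive ha hb1)
  (jacobi_functional_positive ha hb0) LL (shifted_jacobi_functional ha hb1)
  (shifted_jacobi_functional ha hb0) n.
move=> /eqP; rewrite subr_eq addrC => /eqP ->; congr (_ + _ *: _).
rewrite coefB coefXM !coef_shifted_jacobi !ltnS leqnSn jacobi_coef_sub1 //.
case: n => [|n] /=.
  by rewrite /chi /=; field; rewrite gt_eqF //; lra.
rewrite leqnSn jacobi_coef_sub1 // /chi eqSS /= -[n.+2%:R]natr1 -[n.+1%:R]natr1.
have : 0 <= n%:R :> R by rewrite ler0n.
move: (n%:R : R) => x x0; field.
by do ?[apply/andP; split]; rewrite gt_eqF //; lra.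
Qed.

(** The shift of the variable adds one to the middle coefficient. The hypothesis
    on [a + b] keeps the denominator of [lambda_qg] from vanishing at
    [n = 0]. *)
Lemma shifted_jacobi_three_term a b n : -1 < a -> -1 < b -> -1 < a + b ->
  shifted_jacobi a b n.+2
  = ('X - (c_qg a b n.+3 + 1)%:P) * shifted_jacobi a b n.+1
    - lambda_qg a b n.+3 *: shifted_jacobi a b n.
Proof.
move=> ha hb hab; have := mo_three_term (jacobi_functional_positive ha hb)
  (shifted_jacobi_functional ha hb) n.
set J := shifted_jacobi a b; set r := 'X * _ - _ => /=.
have x0 : 0 <= n%:R :> R by rewrite ler0n.
have -> : r`_n.+1 = c_qg a b n.+3 + 1.
  rewrite coefB coefXM !coef_shifted_jacobi !ltnS leqnSn /=.
  rewrite !jacobi_coef_sub1 // /c_qg /= -[n.+2%:R]natr1 -[n.+1%:R]natr1.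
  move: (n%:R : R) x0 => x x0; field.
  by do ?[apply/andP; split]; rewrite gt_eqF //; lra.
have -> : (r - (c_qg a b n.+3 + 1) *: J n.+1)`_n = lambda_qg a b n.+3.
  rewrite /r /J !(coefB, coefXM, coefZ) !coef_shifted_jacobi.
  have ltn3 m : (m < m.+3)%N by rewrite ltnS leqW.
  rewrite ltn3 (ltnS n) leqnSn jacobi_coef_sub2 // jacobi_coef_sub1 //.
  rewrite /c_qg /lambda_qg /= -[n.+2%:R]natr1 -[n.+1%:R]natr1.
  case: n x0 {J r} => [|n] x0 /=.
    by field; do ?[apply/andP; split]; rewrite gt_eqF //; lra.
  rewrite ltn3 jacobi_coef_sub2 // -[n.+1%:R]natr1.
  have : 0 <= n%:R :> R by rewrite ler0n.
  move: (n%:R : R) {x0} => x x0; field.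
  by do ?[apply/andP; split]; rewrite gt_eqF //; lra.
move=> H; rewrite mulrBl mul_polyC -H /r; ring.
Qed.

End JacobiPolynomials.

Theorem mainTheorem7 (R : realType) (alpha beta : R)
    (halpha : -1 < alpha) (hbeta : 0 < beta) :
  [/\ forall n : nat, (2 <= n)%N ->
        c_g alpha beta n.+1 - c_g alpha beta n
          + chi alpha beta n - chi alpha beta n.+1
          - lambda_g alpha beta n.+1 / chi alpha beta n
          + lambda_g alpha beta n / chi alpha beta n.-1 = 0,
      forall n : nat, (1 <= n)%N ->
        quasi_geronimus_jacobi alpha beta n
          = ('X + 1) * jacobi alpha beta n.-1,
      forall n : nat, (2 <= n)%N ->
        quasi_geronimus_jacobi alpha beta n.+1
          = ('X - (c_qg alpha beta n.+1)%:P) * quasi_geronimus_jacobi alpha beta n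
            - lambda_qg alpha beta n.+1 *: quasi_geronimus_jacobi alpha beta n.-1
    & orthogonal_from (jacobi_weight alpha (beta - 2)) 2
        (quasi_geronimus_jacobi alpha beta)].
Proof.
have hb0 : -1 < beta by lra.
have hb1 : -1 < beta - 1 by lra.
have qgE n : quasi_geronimus_jacobi alpha beta n.+1
    = ('X + 1) * jacobi alpha beta n.
  rewrite /quasi_geronimus_jacobi /= !jacobiE // -comp_polyZ -comp_polyD.
  by rewrite -shifted_jacobi_geronimus // comp_polyM comp_polyX.
split.
- case=> [|[|m]] // _; rewrite /c_g /chi /lambda_g /=.
  (* [n = 2] is the only case involving the cancelled forms. *)
  case: m => [|m] /=.
    by field; do ?[apply/andP; split]; rewrite gt_eqF //; lra.
  rewrite -[m.+4%:R]natr1 -[m.+3%:R]natr1 -[m.+2%:R]natr1 -[m.+1%:R]natr1.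
  have : 0 <= m%:R :> R by rewrite ler0n.
  move: (m%:R : R) => x x0; field.
  by do ?[apply/andP; split]; rewrite gt_eqF //; lra.
- by case=> [|n] // _; rewrite qgE.
- case=> [|[|n]] // _; rewrite !qgE !jacobiE // shifted_jacobi_three_term //;
    last by lra.
  rewrite comp_polyB comp_polyZ comp_polyM comp_polyB comp_polyX comp_polyC.
  by rewrite polyCD -!mul_polyC; ring.
- case=> [|[|n]] [|[|m]] // _ _ f.
  have fE x : x \in `]-1, 1[ -> f x =
      (jacobi alpha beta n.+1).[x] * (jacobi alpha beta m.+1).[x]
      * jacobi_weight alpha beta x.
    rewrite in_itv /= => /andP[x1 x2]; have y0 : 0 < 1 + x by lra.
    rewrite /f !qgE !hornerM hornerD hornerX hornerC /jacobi_weight.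
    have -> : beta = beta - 2 + 1 + 1 by ring.
    rewrite !(powR_addr1 _ y0) (_ : beta - 2 + 1 + 1 - 2 = beta - 2); last by ring.
    by rewrite (addrC x 1); ring.
  have [_ /(_ n.+1 m.+1 isT isT) /= [Pint Porth Pnorm]] := jacobiP halpha hb0.
  have intE : \int[lebesgue_measure]_(x in `]-1, 1[) f x =
      \int[lebesgue_measure]_(x in `]-1, 1[)
        ((jacobi alpha beta n.+1).[x] * (jacobi alpha beta m.+1).[x]
         * jacobi_weight alpha beta x).
    by apply: eq_Rintegral => x; rewrite inE; exact: fE.
  rewrite intE; split.
  + apply: eq_integrable Pint => // x; rewrite inE => xI.
    by rewrite /= fE.
  + by move=> nm; apply: Porth => nm'; apply: nm; congr _.+1.
  + by case=> nm; apply: Pnorm; rewrite nm.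
Qed.
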